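(* Let $\mathcal{H}_S$ (system) and $\mathcal{H}_B$ (bath) be finite-dimensional Hilbert spaces, and fix a final time $T>0$. Let $t\mapsto \overline{H}_S(t)$ be a continuous family of Hermitian operators on $\mathcal{H}_S$ (the encoded system Hamiltonian), $H_B$ a Hermitian operator on $\mathcal{H}_B$, and set $H_0(t)=\overline{H}_S(t)\otimes I+I\otimes H_B$. Let $H_{\mathrm{p}}$ be a time-independent Hermitian operator on $\mathcal{H}_S$ (the penalty Hamiltonian, acting as $H_{\mathrm{p}}\otimes I$ on $\mathcal{H}_S\otimes\mathcal{H}_B$) with spectral decomposition $H_{\mathrm{p}}=\sum_a \lambda_a \Pi_a$ (distinct eigenvalues $\lambda_a$, spectral projectors $\Pi_a$), let $E_{\mathrm{p}}>0$, and let $V$ be a time-independent Hermitian operator on $\mathcal{H}_S\otimes\mathcal{H}_B$ (the system–bath interaction). Let $P$ be an orthogonal projection on $\mathcal{H}_S$ (acting as $P\otimes I$). Let $c\in\mathbb{R}$ and $W=cI$. Denote by $U_0(t)$, $U_{\mathrm{p}}(t)=e^{-iE_{\mathrm{p}}H_{\mathrm{p}}t}$ and $U_V(t)$ the unitary evolutions (solutions of $i\,\frac{d}{dt}U=H(t)U$, $U(0)=I$) generated respectively by $H_0(t)$, $E_{\mathrm{p}}H_{\mathrm{p}}$ and $H_V(t)=H_0(t)+E_{\mathrm{p}}H_{\mathrm{p}}+V$. Assume that for all $t\in[0,T]$ $$[\overline{H}_S(t),P]=[\overline{H}_S(t),H_{\mathrm{p}}]=0,$$ and that $$\sum_a \Pi_a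 V\Pi_a P=cP.$$ Then, for any unitarily invariant norm $\|\cdot\|$, $$\lim_{E_{\mathrm{p}}\to\infty}\big\|U_V(T)P-U_W(T)P\big\|=0,\qquad\text{where } U_W(T)=e^{-icT}U_0(T)U_{\mathrm{p}}(T).$$
   Context: All operators on $\mathcal{H}_S$ or $\mathcal{H}_B$ are regarded as operators on $\mathcal{H}_S\otimes\mathcal{H}_B$ by tensoring with the identity. $U_W$ is the evolution generated by $H_W=H_0+E_{\mathrm{p}}H_{\mathrm{p}}+W$ with $W=cI$. A norm is unitarily invariant if $\|UXV\|=\|X\|$ for all unitaries $U,V$. *)

(* Defs.v *)
From HB Require Import structures.
From mathcomp Require Import all_boot all_order all_algebra.
From mathcomp Require Import all_classical all_reals all_analysis.
From mathcomp Require Import complex mxtens.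
Set Implicit Arguments. Unset Strict Implicit. Unset Printing Implicit Defensive.
Import Order.TTheory GRing.Theory Num.Theory.
Local Open Scope ring_scope.

Notation "x %:CC" := ((x%:C)%C) (at level 2, format "x %:CC").

Definition cexpi (R : realType) (x : R) : R[i] := (cos x +i* sin x)%C.

Definition herm (R : realType) n (A : 'M[R[i]]_n) : Prop :=
  (A ^t* = A)%sesqui.

Definition orth_proj (R : realType) n (P : 'M[R[i]]_n) : Prop :=
  herm P /\ P *m P = P.

Definition mx_cont_on (R : realType) n (a b : R) (F : R -> 'M[R[i]]_n) : Prop :=
  forall t, a <= t <= b ->
  forall eps : R, 0 < eps -> exists2 delta : R, 0 < delta &
    forall s, a <= s <= b -> `|s - t| < delta ->
    forall i j, `|F s i j - F t i j| < eps%:CC.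

Definition mx_deriv_within (R : realType) n (a b : R) (U : R -> 'M[R[i]]_n)
    (t : R) (D : 'M[R[i]]_n) : Prop :=
  forall eps : R, 0 < eps -> exists2 delta : R, 0 < delta &
    forall h : R, h != 0 -> `|h| < delta -> a <= t + h <= b ->
    forall i j, `|(U (t + h) i j - U t i j) / h%:CC - D i j| < eps%:CC.

Definition is_evolution (R : realType) n (T : R) (H : R -> 'M[R[i]]_n)
    (U : R -> 'M[R[i]]_n) : Prop :=
  U 0 = 1%:M /\
  forall t, 0 <= t <= T -> exists2 D, mx_deriv_within 0 T U t D &
     ('i)%C *: D = H t *m U t.

Definition unit_inv_norm (R : realType) n (nrm : 'M[R[i]]_n -> R) : Prop :=
  [/\ forall X, 0 <= nrm X,
      forall X, nrm X = 0 -> X = 0,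
      forall (a : R[i]) X, (nrm (a *: X))%:CC = `|a| * (nrm X)%:CC,
      forall X Y, nrm (X + Y) <= nrm X + nrm Y
    & forall U V X, U \is unitarymx -> V \is unitarymx ->
        nrm (U *m X *m V) = nrm X].

(* Main.v *)
Require Import Defs.
From HB Require Import structures.
From mathcomp Require Import all_boot all_order all_algebra.
From mathcomp Require Import all_classical all_reals all_analysis.
From mathcomp Require Import complex mxtens.
From mathcomp Require Import ring lra.
Import Order.TTheory GRing.Theory Num.Theory.
Import numFieldNormedType.Exports.
Import ComplexField.
Local Open Scope classical_set_scope.
Local Open Scope sesquilinear_scope.
Local Open Scope ring_scope.
Set Implicit Arguments. Unset Strict Implicit. Unset Printing Implicit Defensive.

(** Put [D = \sum_a Pi_a V Pi_a] and
    [L = \sum_(a != b) (lam_b - lam_a)^-1 Pi_b V Pi_a], so that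
    [[Hp, L] = V - D].  The evolution [U_W = e^(-ict) U_0 U_p] is generated by
    [H_0 + E Hp + c], and [D P = c P] propagates to [(D - c) U_W P = 0], because
    [D] commutes with [U_p] and [U_0] commutes with [U_p] and [P].  Hence the
    derivative of [F = U_V^* (1 - L/E) U_W P] loses its terms of order one:
    [F' = - (i/E) U_V^* ([H_0, L] + (V - c) L) U_W P], which is [O(1/E)].  By the
    mean value inequality [F T - F 0 = O(1/E)], and this is [U_W P - U_V P] up to
    the unitary factor [U_V] and another [O(1/E)].  All norms on matrices being
    comparable, any one of them may be used for the estimates. *)

(** * Entrywise l1 norm, adjoints and tensor products *)

Lemma normc_sum (R : realType) (I : finType) (F : I -> R[i]) :
  Normc.normc (\sum_i F i) <= \sum_i Normc.normc (F i).
Proof.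
apply: (big_ind2 (fun z r => Normc.normc z <= r)) => [|x a y b xa yb|//].
  by rewrite Normc.normc0.
exact: le_trans (le_normcD _ _) (lerD xa yb).
Qed.

(** Values are taken in [R] rather than [R[i]], so that real limits and real suprema apply directly.
    This norm is submultiplicative and invariant under adjoints without any constant. *)
Definition mxnorm1 (R : realType) m n (A : 'M[R[i]]_(m, n)) : R :=
  \sum_i \sum_j Normc.normc (A i j).

Lemma normc_ge0 (R : realType) (z : R[i]) : 0 <= Normc.normc z.
Proof. by rewrite -lecR (normr_ge0 z). Qed.

Lemma mxnorm1_ge0 (R : realType) m n (A : 'M[R[i]]_(m, n)) : 0 <= mxnorm1 A.
Proof. by do 2!(apply: sumr_ge0 => ? _); exact: normc_ge0. Qed.

Lemma normc_le_mxnorm1 (R : realType) m n (A : 'M[R[i]]_(m, n)) i j :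
  Normc.normc (A i j) <= mxnorm1 A.
Proof.
rewrite /mxnorm1 (bigD1 i)//= (bigD1 j)//= -addrA lerDl addr_ge0//.
  by apply: sumr_ge0 => ? _; exact: normc_ge0.
by do 2!(apply: sumr_ge0 => ? _); exact: normc_ge0.
Qed.

Lemma mxnorm1_le (R : realType) m n (A : 'M[R[i]]_(m, n)) e :
  (forall i j, Normc.normc (A i j) <= e) -> mxnorm1 A <= (m * n)%:R * e.
Proof.
move=> Ae; apply: (@le_trans _ _ (\sum_(i < m) \sum_(j < n) e)).
  by do 2!(apply: ler_sum => ? _); exact: Ae.
by rewrite !sumr_const !card_ord -mulrnA mulnC mulr_natl.
Qed.

Lemma mxnorm1D (R : realType) m n (A B : 'M[R[i]]_(m, n)) :
  mxnorm1 (A + B) <= mxnorm1 A + mxnorm1 B.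
Proof.
rewrite -big_split; apply: ler_sum => i _; rewrite -big_split.
by apply: ler_sum => j _; rewrite mxE le_normcD.
Qed.

Lemma mxnorm1Z (R : realType) m n a (A : 'M[R[i]]_(m, n)) :
  mxnorm1 (a *: A) = Normc.normc a * mxnorm1 A.
Proof.
rewrite mulr_sumr; apply: eq_bigr => i _; rewrite mulr_sumr.
by apply: eq_bigr => j _; rewrite mxE Normc.normcM.
Qed.

Lemma normc_real (R : realType) (r : R) : Normc.normc r%:CC = `|r|.
Proof. by rewrite /= expr0n addr0 sqrtr_sqr. Qed.

Lemma mxnorm1N (R : realType) m n (A : 'M[R[i]]_(m, n)) :
  mxnorm1 (- A) = mxnorm1 A.
Proof. by do 2!(apply: eq_bigr => ? _); rewrite mxE normcN. Qed.

Lemma mxnorm1B (R : realType) m n (A B : 'M[R[i]]_(m, n)) :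
  mxnorm1 (A - B) <= mxnorm1 A + mxnorm1 B.
Proof. by rewrite -(mxnorm1N B); exact: mxnorm1D. Qed.

Lemma mxnorm1_0 (R : realType) m n : mxnorm1 (0 : 'M[R[i]]_(m, n)) = 0.
Proof. by rewrite -(scale0r 0) mxnorm1Z Normc.normc0 mul0r. Qed.

Lemma mxnorm1_eq0 (R : realType) m n (A : 'M[R[i]]_(m, n)) :
  mxnorm1 A <= 0 -> A = 0.
Proof.
move=> A0; apply/matrixP => i j; rewrite mxE; apply: Normc.eq0_normc.
by apply/eqP; rewrite eq_le normc_ge0 (le_trans (normc_le_mxnorm1 A i j)).
Qed.

Lemma mxnorm1M (R : realType) m n p (A : 'M[R[i]]_(m, n))
    (B : 'M[R[i]]_(n, p)) :
  mxnorm1 (A *m B) <= mxnorm1 A * mxnorm1 B.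
Proof.
rewrite mulr_suml; apply: ler_sum => i _.
have : \sum_k Normc.normc ((A *m B) i k) <=
       \sum_k \sum_j Normc.normc (A i j) * Normc.normc (B j k).
  apply: ler_sum => k _; rewrite mxE; apply: le_trans (normc_sum _) _.
  by apply: ler_sum => j _; rewrite Normc.normcM.
(* After the exchange of sums, the entry [A i j] multiplies the [j]-th row sum of [B], which is at
   most the sum over all rows. *)
move=> /le_trans; apply; rewrite exchange_big mulr_suml; apply: ler_sum => j _.
rewrite -mulr_sumr ler_wpM2l ?normc_ge0//.
rewrite /mxnorm1 (bigD1 j)//= lerDl.
by do 2!(apply: sumr_ge0 => ? _); exact: normc_ge0.
Qed.

Lemma normc_conj (R : realType) (z : R[i]) : Normc.normc (z^*)%C = Normc.normc z.
Proof. by case: z => a b /=; rewrite sqrrN. Qed.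

Lemma mxnorm1_adj (R : realType) m n (A : 'M[R[i]]_(m, n)) :
  mxnorm1 (A ^t*) = mxnorm1 A.
Proof.
rewrite /mxnorm1 exchange_big; do 2!(apply: eq_bigr => ? _).
by rewrite !mxE normc_conj.
Qed.

Lemma mxnorm1_dist (R : realType) m n (A B : 'M[R[i]]_(m, n)) :
  `|mxnorm1 A - mxnorm1 B| <= mxnorm1 (A - B).
Proof.
rewrite ler_norml; apply/andP; split.
  rewrite lerBrDr addrC lerBlDr -[X in _ <= _ + X]mxnorm1N opprB addrC.
  by apply: le_trans (mxnorm1D _ _); rewrite subrK.
by rewrite lerBlDr; apply: le_trans (mxnorm1D _ _); rewrite subrK.
Qed.

Lemma mxadjM (R : realType) m n p (A : 'M[R[i]]_(m, n)) (B : 'M[R[i]]_(n, p)) :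
  (A *m B) ^t* = B ^t* *m A ^t*.
Proof. by rewrite trmx_mul map_mxM. Qed.

Lemma mxadjD (R : realType) m n (A B : 'M[R[i]]_(m, n)) :
  (A + B) ^t* = A ^t* + B ^t*.
Proof. by apply/matrixP => i j; rewrite !mxE rmorphD. Qed.

Lemma mxadjB (R : realType) m n (A B : 'M[R[i]]_(m, n)) :
  (A - B) ^t* = A ^t* - B ^t*.
Proof. by apply/matrixP => i j; rewrite !mxE rmorphB. Qed.

Lemma mxadjZ (R : realType) m n a (A : 'M[R[i]]_(m, n)) :
  (a *: A) ^t* = a^* *: A ^t*.
Proof. by apply/matrixP => i j; rewrite !mxE rmorphM. Qed.

Lemma mxadj_real (R : realType) m n (a : R) (A : 'M[R[i]]_(m, n)) :
  (a%:CC *: A) ^t* = a%:CC *: A ^t*.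
Proof. by rewrite mxadjZ; congr (_ *: _); exact: conjc_real. Qed.

Lemma mxadj_tens (R : realType) m n p q (A : 'M[R[i]]_(m, n))
    (B : 'M[R[i]]_(p, q)) :
  (A *t B) ^t* = A ^t* *t B ^t*.
Proof. by rewrite trmx_tens map_mxT. Qed.

Lemma mxadj1 (R : realType) n : (1%:M : 'M[R[i]]_n) ^t* = 1%:M.
Proof. by rewrite trmx1 map_mx1. Qed.

Lemma tensmxZl (R : comPzRingType) m n p q a (A : 'M[R]_(m, n))
  (B : 'M[R]_(p, q)) : (a *: A) *t B = a *: (A *t B).
Proof. by apply/matrixP => i j; rewrite !mxE mulrA. Qed.

Lemma tensmx_suml (R : comPzRingType) (I : finType) m n p q
  (A : I -> 'M[R]_(m, n)) (B : 'M[R]_(p, q)) :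
  (\sum_a A a) *t B = \sum_a (A a *t B).
Proof.
apply/matrixP => i j; rewrite !mxE !summxE mulr_suml.
by apply: eq_bigr => a _; rewrite !mxE.
Qed.

Lemma tensmx11 (R : comPzRingType) m n :
  (1%:M : 'M[R]_m) *t (1%:M : 'M[R]_n) = 1%:M.
Proof.
apply/matrixP => i j.
case: (mxtens_indexP i) => i0 i1; case: (mxtens_indexP j) => j0 j1.
rewrite tensmxE !mxE (can_eq (@mxtens_indexK _ _)) xpair_eqE.
by case: eqP; case: eqP; rewrite ?mulr1 ?mul0r ?mulr0.
Qed.

(** Every entry is a product of two entries, and the factor in front counts the entries. Such a
    crude constant suffices because it does not involve the penalty strength. *)
Lemma mxnorm1_tens (R : realType) m n p q (A : 'M[R[i]]_(m, n))
    (B : 'M[R[i]]_(p, q)) :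
  mxnorm1 (A *t B) <= ((m * p) * (n * q))%:R * (mxnorm1 A * mxnorm1 B).
Proof.
apply: mxnorm1_le => i j; rewrite mxE Normc.normcM.
by apply: ler_pM; rewrite ?normc_ge0 ?normc_le_mxnorm1.
Qed.

(** * Derivatives of matrix-valued functions *)

(** Derivatives are one-sided at the ends of the interval. The filter is improper if no increment is
    admissible, as for [T = t = 0], so only an instance of [Filter] is declared below. *)
Definition increments (R : realType) (T t : R) : set_system R :=
  within (fun h => h != 0 /\ 0 <= t + h <= T) (nbhs (0 : R)).

#[local] Instance increments_filter (R : realType) (T t : R) :
  Filter (increments T t).
Proof. exact: within_filter. Qed.

(** Measuring the error by a real number turns differentiability into a limit of real functions, to
    which squeezing applies. *)
Definition diff_err (R : realType) n (U : R -> 'M[R[i]]_n) t D (h : R) : R :=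
  mxnorm1 ((h^-1)%:CC *: (U (t + h) - U t) - D).

Definition mx_deriv (R : realType) n (T : R) (U : R -> 'M[R[i]]_n) t D : Prop :=
  diff_err U t D h @[h --> increments T t] --> (0 : R).

Lemma mx_deriv_of_within (R : realType) n (T : R) (U : R -> 'M[R[i]]_n) t D :
  mx_deriv_within 0 T U t D -> mx_deriv T U t D.
Proof.
move=> dU; apply/cvgrPdist_le => e e0.
(* The successor keeps the denominator positive when [n = 0]. *)
have e'0 : 0 < e / (n * n).+1%:R by rewrite divr_gt0.
have [d d0 dP] := dU _ e'0.
apply/nbhs_ballP; exists d => //= h; rewrite /ball/= sub0r normrN => hd [h0 hT].
rewrite sub0r normrN ger0_norm ?mxnorm1_ge0//.
apply: (@le_trans _ _ ((n * n)%:R * (e / (n * n).+1%:R))); last first.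
  by rewrite mulrCA ger_pMr// ler_pdivrMr// mul1r ler_nat.
apply: mxnorm1_le => i j; apply: ltW; rewrite -ltcR.
by have := dP _ h0 hd hT i j; rewrite !mxE fmorphV/= mulrC.
Qed.

Lemma near_increments (R : realType) (T t : R) :
  \forall h \near increments T t, h != 0 /\ 0 <= t + h <= T.
Proof. by apply/nbhs_ballP; exists 1 => //= h _. Qed.

Lemma cvg_increments (R : realType) (T t : R) :
  `|h| @[h --> increments T t] --> (0 : R).
Proof.
apply/cvgrPdist_le => e e0; apply/nbhs_ballP; exists e => //= h.
by rewrite /ball/= !sub0r !normrN normr_id => /ltW.
Qed.

Lemma mxnorm1_increment_le (R : realType) n (U : R -> 'M[R[i]]_n) t D h : h != 0 ->
  mxnorm1 (U (t + h) - U t) <= `|h| * (diff_err U t D h + mxnorm1 D).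
Proof.
move=> h0; have -> : U (t + h) - U t =
    h%:CC *: (((h^-1)%:CC *: (U (t + h) - U t) - D) + D).
  by rewrite subrK scalerA -rmorphM/= mulfV// scale1r.
by rewrite mxnorm1Z normc_real ler_wpM2l// mxnorm1D.
Qed.

Lemma mx_derivM (R : realType) n (T : R) (A B : R -> 'M[R[i]]_n) t A' B' :
  mx_deriv T A t A' -> mx_deriv T B t B' ->
  mx_deriv T (fun s => A s *m B s) t (A' *m B t + A t *m B').
Proof.
move=> dA dB.
(* [G] bounds the three terms into which the error of the product is split below. In it, [B (t + h)]
   is estimated by [B t] plus an increment of size [O(h)]. *)
pose G h := diff_err A t A' h *
     (`|h| * (diff_err B t B' h + mxnorm1 B') + mxnorm1 (B t))
   + mxnorm1 A' * (`|h| * (diff_err B t B' h + mxnorm1 B'))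
   + mxnorm1 (A t) * diff_err B t B' h.
have G0 : G h @[h --> increments T t] --> (0 : R).
  have -> : (0 : R) = 0 * (0 * (0 + mxnorm1 B') + mxnorm1 (B t)) +
      mxnorm1 A' * (0 * (0 + mxnorm1 B')) + mxnorm1 (A t) * 0 by ring.
  have c0 := @cvg_increments R T t.
  have c1 : `|h| * (diff_err B t B' h + mxnorm1 B')
     @[h --> increments T t] --> (0 * (0 + mxnorm1 B')).
    by apply: cvgM => //; apply: cvgD => //; exact: cvg_cst.
  apply: cvgD; [apply: cvgD|]; (apply: cvgM => //; try exact: cvg_cst).
  by apply: cvgD => //; exact: cvg_cst.
apply: (@squeeze_cvgr _ _ _ _ (fun=> 0) G) => //; last exact: cvg_cst.
near=> h; have [h0 _] : h != 0 /\ 0 <= t + h <= T.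
  by near: h; exact: near_increments.
rewrite mxnorm1_ge0/=.
have dBh := mxnorm1_increment_le B t B' h0.
have -> : diff_err (fun s => A s *m B s) t (A' *m B t + A t *m B') h =
  mxnorm1 (((h^-1)%:CC *: (A (t + h) - A t) - A') *m B (t + h)
   + A' *m (B (t + h) - B t)
   + A t *m ((h^-1)%:CC *: (B (t + h) - B t) - B')).
  congr mxnorm1; rewrite mulmxBl 2!mulmxBr -scalemxAl -scalemxAr mulmxBl mulmxBr.
  rewrite [in RHS]scalerBr; move: (A t *m B t) (A t *m B').
  move: (A (t + h) *m B (t + h)) (A t *m B (t + h)) (A' *m B t) (A' *m B (t + h)).
  move=> a b d e f g.
  by apply/matrixP => i j; rewrite !mxE; ring.
apply: le_trans (mxnorm1D _ _) _; apply: lerD; last first.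
  exact: mxnorm1M.
apply: le_trans (mxnorm1D _ _) _; apply: lerD; last first.
  by apply: le_trans (mxnorm1M _ _) _; rewrite ler_wpM2l ?mxnorm1_ge0.
apply: le_trans (mxnorm1M _ _) _; rewrite ler_wpM2l ?mxnorm1_ge0//.
rewrite -[X in mxnorm1 X](subrK (B t)).
by apply: le_trans (mxnorm1D _ _) _; rewrite lerD2r.
Unshelve. all: by end_near.
Qed.

Lemma mx_deriv_cst (R : realType) n (T : R) (A : 'M[R[i]]_n) t :
  mx_deriv T (fun=> A) t 0.
Proof.
rewrite /mx_deriv (_ : diff_err _ _ _ = fun=> 0); last first.
  apply/funext => h; by rewrite /diff_err subrr scaler0 subrr mxnorm1_0.
exact: cvg_cst.
Qed.

Lemma mx_derivMl (R : realType) n (T : R) (X : 'M[R[i]]_n)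
    (A : R -> 'M[R[i]]_n) t A' :
  mx_deriv T A t A' -> mx_deriv T (fun s => X *m A s) t (X *m A').
Proof.
by move=> dA; have := mx_derivM (@mx_deriv_cst R n T X t) dA; rewrite mul0mx add0r.
Qed.

Lemma mx_derivMr (R : realType) n (T : R) (X : 'M[R[i]]_n)
    (A : R -> 'M[R[i]]_n) t A' :
  mx_deriv T A t A' -> mx_deriv T (fun s => A s *m X) t (A' *m X).
Proof.
by move=> dA; have := mx_derivM dA (@mx_deriv_cst R n T X t); rewrite mulmx0 addr0.
Qed.

Lemma mx_derivB (R : realType) n (T : R) (A B : R -> 'M[R[i]]_n) t A' B' :
  mx_deriv T A t A' -> mx_deriv T B t B' ->
  mx_deriv T (fun s => A s - B s) t (A' - B').
Proof.
move=> dA dB; have /= dAB := cvgD dA dB; rewrite addr0 in dAB; rewrite /mx_deriv.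
apply: (@squeeze_cvgr _ _ _ _ (fun=> 0)
  (fun h => diff_err A t A' h + diff_err B t B' h) _ _ 0 _ (dAB _));
  last exact: cvg_cst.
near=> h; rewrite mxnorm1_ge0/=.
apply: le_trans (mxnorm1B _ _); rewrite /diff_err le_eqVlt; apply/orP; left.
apply/eqP; congr mxnorm1; rewrite !scalerBr.
by apply/matrixP => i j; rewrite !mxE; ring.
Unshelve. all: by end_near.
Qed.

Lemma mx_deriv_adj (R : realType) n (T : R) (A : R -> 'M[R[i]]_n) t A' :
  mx_deriv T A t A' -> mx_deriv T (fun s => (A s) ^t*) t (A' ^t*).
Proof.
move=> dA; rewrite /mx_deriv (_ : diff_err _ _ _ = diff_err A t A')//.
by apply/funext => h; rewrite /diff_err -[RHS]mxnorm1_adj mxadjB mxadj_real mxadjB.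
Qed.

(** * Mean value inequality and Schroedinger equations *)

(** The witness is the conjugate of [z] divided by its modulus, and zero when [z = 0]. *)
Lemma normc_phase (R : realType) (z : R[i]) :
  exists2 w : R[i], Normc.normc w <= 1 & complex.Re (w * z) = Normc.normc z.
Proof.
have [->|z0] := eqVneq z 0.
  by exists 0; rewrite ?mul0r Normc.normc0.
have r0 : Normc.normc z != 0 by apply: contra z0 => /eqP/Normc.eq0_normc ->.
exists ((z^*)%C * ((Normc.normc z)^-1)%:CC).
  rewrite Normc.normcM normc_conj normc_real ger0_norm ?invr_ge0 ?normc_ge0//.
  by rewrite mulfV.
have zz : complex.Re ((z^*)%C * z) = Normc.normc z ^+ 2.
  case: {r0 z0} z => a b /=; rewrite sqr_sqrtr ?addr_ge0 ?sqr_ge0//; ring.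
rewrite mulrAC; case: (_ * z) zz => a b /= ->; field.
by rewrite r0.
Qed.

Lemma normr_Re_le (R : realType) (z : R[i]) : `|complex.Re z| <= Normc.normc z.
Proof. by rewrite -lecR; exact: normc_ge_Re. Qed.

(* Composing with such a functional reduces the mean value inequality for
   matrices to the scalar mean value theorem, without losing a constant. *)
Lemma mxnorm1_functional (R : realType) n (Z : 'M[R[i]]_n) :
  exists Phi : 'M[R[i]]_n -> R,
  [/\ forall X Y, Phi (X - Y) = Phi X - Phi Y,
      forall (r : R) X, Phi (r%:CC *: X) = r * Phi X,
      forall X, `|Phi X| <= mxnorm1 X
    & Phi Z = mxnorm1 Z].
Proof.
have /choice[w wP] : forall ij : 'I_n * 'I_n, exists w : R[i],
    Normc.normc w <= 1 /\ complex.Re (w * Z ij.1 ij.2) = Normc.normc (Z ij.1 ij.2).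
  by move=> ij; have [w] := normc_phase (Z ij.1 ij.2); exists w.
exists (fun X => \sum_i \sum_j complex.Re (w (i, j) * X i j)); split.
- move=> X Y; rewrite -sumrB; apply: eq_bigr => i _; rewrite -sumrB.
  by apply: eq_bigr => j _; rewrite !mxE mulrBr raddfB.
- move=> r X; rewrite mulr_sumr; apply: eq_bigr => i _; rewrite mulr_sumr.
  apply: eq_bigr => j _; rewrite !mxE mulrCA; case: (w _ * _) => a b /=.
  by rewrite mul0r subr0.
- move=> X; apply: le_trans (ler_norm_sum _ _ _) _; apply: ler_sum => i _.
  apply: le_trans (ler_norm_sum _ _ _) _; apply: ler_sum => j _.
  apply: le_trans (normr_Re_le _) _; rewrite Normc.normcM.
  by have [w1 _] := wP (i, j); rewrite ler_piMl ?normc_ge0.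
- apply: eq_bigr => i _; apply: eq_bigr => j _; exact: (wP (i, j)).2.
Qed.

Lemma mx_mean_value (R : realType) n (T M : R) (F F' : R -> 'M[R[i]]_n) t :
  0 <= t <= T ->
  (forall s, 0 <= s <= T -> mx_deriv T F s (F' s)) ->
  (forall s, 0 <= s <= T -> mxnorm1 (F' s) <= M) ->
  mxnorm1 (F t - F 0) <= M * t.
Proof.
move=> /andP[t0 tT] dF F'M.
have [Phi [PhiB PhiZ Phi_le <-]] := mxnorm1_functional (F t - F 0).
rewrite PhiB.
have in0T s : 0 <= s <= t -> 0 <= s <= T.
  by move=> /andP[-> /le_trans->].
have [||c] := @MVT_segment R (Phi \o F) (Phi \o F') 0 t t0.
- move=> x; rewrite in_itv/= => /andP[x0 xt].
  have x0T : 0 <= x <= T by rewrite in0T// !ltW.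
  have lim : h^-1 *: ((Phi \o F) (h *: 1 + x) - (Phi \o F) x) @[h --> 0^'] -->
      Phi (F' x).
    apply/cvgrPdist_le => e e0.
    have /cvgrPdist_le/(_ e e0)/nbhs_ballP[d /= d0 dP] := dF x x0T.
    (* Besides being below [d], the increment must keep [x + h] inside the interval on which [F] is
       known to be differentiable. *)
    have m0 : 0 < Num.min d (Num.min x (t - x)).
      by rewrite !lt_min d0 x0 subr_gt0.
    apply/nbhs_ballP; exists (Num.min d (Num.min x (t - x))) => //= h.
    rewrite /ball/= sub0r normrN !lt_min => /and3P[hd hx htx] h0.
    have {}hx : - h < x by rewrite (le_lt_trans _ hx)// -normrN ler_norm.
    have {}htx : h < t - x by rewrite (le_lt_trans _ htx)// ler_norm.
    have := dP h; rewrite /ball/= sub0r normrN => /(_ hd).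
    have -> : 0 <= x + h <= T.
      by apply: in0T; lra.
    rewrite sub0r normrN ger0_norm ?mxnorm1_ge0// => /(_ (conj h0 isT)).
    apply: le_trans; rewrite distrC /diff_err.
    apply: le_trans (Phi_le _); rewrite !PhiB PhiZ PhiB.
    by rewrite [h%:A]mulr1 [h + x]addrC.
  have dv : derivable (Phi \o F) x 1 by apply/cvg_ex; exists (Phi (F' x)).
  by apply: DeriveDef => //; exact: cvg_lim.
- apply/subspace_continuousP => x /=; rewrite in_itv/= => xt.
  have x0T := in0T _ xt.
  have /cvgrPdist_le/(_ 1 ltr01)/nbhs_ballP[d /= d0 dP] := dF x x0T.
  apply/cvgrPdist_le => e e0.
  (* Within distance [d] of [x] the difference quotient is off by at most one, so increments of [F]
     from [x] are at most [K] times the distance. *)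
  set K := 1 + mxnorm1 (F' x).
  have K0 : 0 < K by rewrite ltr_pwDl// mxnorm1_ge0.
  have m0 : 0 < Num.min d (e / K) by rewrite lt_min d0 divr_gt0.
  apply/nbhs_ballP; exists (Num.min d (e / K)) => //= s.
  rewrite /ball/= lt_min => /andP[sd se]; rewrite in_itv/= => st.
  have [->|sx] := eqVneq s x; first by rewrite subrr normr0 ltW.
  have h0 : s - x != 0 by rewrite subr_eq0.
  rewrite distrC -PhiB; apply: le_trans (Phi_le _) _.
  have sE : s = x + (s - x) by rewrite addrC subrK.
  rewrite {1}sE; apply: le_trans (mxnorm1_increment_le _ _ (F' x) h0) _.
  rewrite distrC ltr_pdivlMr// in se.
  have := dP (s - x); rewrite /ball/= sub0r normrN distrC => /(_ sd).
  rewrite -sE => /(_ (conj h0 (in0T _ st))).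
  rewrite sub0r normrN ger0_norm ?mxnorm1_ge0// => err.
  apply: le_trans (ltW se); rewrite distrC ler_wpM2l//.
  by rewrite lerD2r.
rewrite in_itv/= subr0 => ct /= ->; rewrite ler_wpM2r//.
by apply: le_trans (F'M _ (in0T _ ct)); apply: le_trans (Phi_le _); rewrite ler_norm.
Qed.

(** No initial value is imposed, so that the notion also covers solutions starting at zero, such as
    commutators with an evolution. *)
Definition solves (R : realType) n (T : R) (H U : R -> 'M[R[i]]_n) : Prop :=
  forall t, 0 <= t <= T -> mx_deriv T U t ((- 'i%C) *: (H t *m U t)).

Lemma evolution_solves (R : realType) n (T : R) (H U : R -> 'M[R[i]]_n) :
  is_evolution T H U -> solves T H U.
Proof.
move=> [_ dU] t /dU[D /mx_deriv_of_within dUt HD]; rewrite -HD scalerA.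
by rewrite mulNr -expr2 sqr_i opprK scale1r.
Qed.

(** The derivative of [X^* Y] is [X^* (iH - iH) Y = 0] because [H] is Hermitian, and the mean value
    inequality with bound zero makes the product constant. *)
Lemma solves_inner (R : realType) n (T : R) (H X Y : R -> 'M[R[i]]_n) t :
  (forall s, 0 <= s <= T -> herm (H s)) -> solves T H X -> solves T H Y ->
  0 <= t <= T -> (X t) ^t* *m Y t = (X 0) ^t* *m Y 0.
Proof.
move=> Hherm sX sY tT; apply/eqP; rewrite -subr_eq0; apply/eqP.
apply: mxnorm1_eq0; rewrite -[leRHS](mul0r t).
apply: (@mx_mean_value _ _ T _ (fun s => (X s) ^t* *m Y s) (fun=> 0)) => //.
- move=> s sT; have := mx_derivM (mx_deriv_adj (sX s sT)) (sY s sT).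
  rewrite mxadjZ mxadjM Hherm// -scalemxAl -scalemxAr !mulmxA -scalerDl.
  have -> : (- 'i%C)^* + - 'i%C = 0 :> R[i].
    rewrite rmorphN -opprD; apply/eqP.
    by rewrite oppr_eq0 eq_complex/= add0r addNr !eqxx.
  by rewrite scale0r.
- by move=> s _; rewrite mxnorm1_0.
Qed.

Lemma solves_adjM (R : realType) n (T : R) (H U : R -> 'M[R[i]]_n) t :
  (forall s, 0 <= s <= T -> herm (H s)) -> solves T H U -> U 0 = 1%:M ->
  0 <= t <= T -> (U t) ^t* *m U t = 1%:M.
Proof.
by move=> Hherm sU U0 tT; rewrite (solves_inner Hherm sU sU tT) U0 mxadj1 mulmx1.
Qed.

(** The commutator [Z = X U - U X] solves the same equation and vanishes at time zero. Hence [U^* Z]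
    is constantly zero, and unitarity of [U] gives [Z = 0]; this stands in for a uniqueness
    theorem. *)
Lemma solves_comm (R : realType) n (T : R) (H U : R -> 'M[R[i]]_n) X t :
  (forall s, 0 <= s <= T -> herm (H s)) -> solves T H U -> U 0 = 1%:M ->
  (forall s, 0 <= s <= T -> X *m H s = H s *m X) ->
  0 <= t <= T -> X *m U t = U t *m X.
Proof.
move=> Hherm sU U0 XH tT; apply/eqP; rewrite -subr_eq0; apply/eqP.
pose Z s := X *m U s - U s *m X.
have sZ : solves T H Z.
  move=> s sT; have := mx_derivB (mx_derivMl X (sU s sT)) (mx_derivMr X (sU s sT)).
  congr mx_deriv; rewrite -scalemxAl -scalemxAr -scalerBr /Z mulmxBr.
  by rewrite (mulmxA X) XH// !mulmxA.
have UZ : (U t) ^t* *m Z t = 0.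
  rewrite (solves_inner Hherm sU sZ tT) /Z U0.
  by rewrite mulmx1 mul1mx subrr mulmx0.
have /mulmx1C UU := solves_adjM Hherm sU U0 tT.
by rewrite -[LHS]mul1mx -UU -mulmxA UZ mulmx0.
Qed.

(** The columns have Euclidean length one, so each of the [n * n] entries has modulus at most
    one. *)
Lemma mxnorm1_unitary (R : realType) n (U : 'M[R[i]]_n) :
  U ^t* *m U = 1%:M -> mxnorm1 U <= (n * n)%:R.
Proof.
move=> UU; rewrite -[leRHS]mulr1; apply: mxnorm1_le => i j.
have : \sum_k Normc.normc (U k j) ^+ 2 = 1.
  apply: (@complexI R); rewrite rmorph_sum rmorph1.
  have := congr1 (fun X : 'M[R[i]]_n => X j j) UU; rewrite !mxE eqxx mulr1n => <-.
  apply: eq_bigr => k _; rewrite !mxE mulrC.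
  by rewrite -[RHS]sqr_normc rmorphXn.
move=> U1; rewrite -(@ler_pXn2r _ 2) ?nnegrE ?normc_ge0// expr1n -U1.
by rewrite (bigD1 i)//= lerDl; apply: sumr_ge0 => k _; rewrite exprn_ge0 ?normc_ge0.
Qed.

(** * The error bound at fixed penalty strength *)

Lemma is_derive_increments (R : realType) (T t : R) (f : R -> R) df :
  is_derive t 1 f df ->
  `|h^-1 * (f (t + h) - f t) - df| @[h --> increments T t] --> (0 : R).
Proof.
move=> [fd <-]; have := fd; move=> /cvgrPdist_le fl.
apply/cvgrPdist_le => e e0; have := fl e e0.
move=> /nbhs_ballP[d /= d0 dP]; apply/nbhs_ballP; exists d => //= h hd [h0 _].
rewrite sub0r normrN normr_id distrC; apply: le_trans (dP h hd h0).
by rewrite [h%:A]mulr1 [h + t]addrC.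
Qed.

Lemma normc_le_ReIm (R : realType) (a b : R) :
  Normc.normc (a +i* b)%C <= `|a| + `|b|.
Proof.
have -> : (a +i* b)%C = (a +i* 0)%C + (0 +i* b)%C.
  by apply/eqP; rewrite eq_complex/= addr0 add0r !eqxx.
apply: le_trans (le_normcD _ _) _.
by rewrite /= !expr0n/= addr0 add0r !sqrtr_sqr.
Qed.

(** The phase is carried by a scalar matrix so that the product rule [mx_derivM] applies to it. Its
    real and imaginary parts are differentiated separately, as cosine and sine. *)
Lemma mx_deriv_cexpi (R : realType) n (T c t : R) :
  mx_deriv T (fun s => cexpi (- (c * s)) *: (1%:M : 'M[R[i]]_n)) t
    ((- 'i%C * c%:CC * cexpi (- (c * t))) *: 1%:M).
Proof.
have dlin : is_derive t 1 (fun s => - (c * s)) (- c).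
  by apply: is_derive_eq; rewrite /GRing.scale/= mulr1.
have dcos := is_derive_increments T (is_derive1_comp (is_derive_cos _) dlin).
have dsin := is_derive_increments T (is_derive1_comp (is_derive_sin _) dlin).
pose err (f : R -> R) df h := `|h^-1 * (f (t + h) - f t) - df|.
pose ferr h := (err (cos \o (fun s => - (c * s))) (- sin (- (c * t)) * - c) h
  + err (sin \o (fun s => - (c * s))) (cos (- (c * t)) * - c) h)
  * mxnorm1 (1%:M : 'M[R[i]]_n).
have ferr0 : ferr h @[h --> increments T t] --> (0 : R).
  have -> : (0 : R) = (0 + 0) * mxnorm1 (1%:M : 'M[R[i]]_n) by ring.
  by apply: cvgM; [exact: cvgD|exact: cvg_cst].
apply: (@squeeze_cvgr _ _ _ _ (fun=> 0) ferr) => //; last exact: cvg_cst.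
near=> h; rewrite mxnorm1_ge0/= /diff_err -scalerBl scalerA -scalerBl mxnorm1Z.
rewrite ler_wpM2r ?mxnorm1_ge0//; apply: le_trans (normc_le_ReIm _ _).
rewrite le_eqVlt; apply/orP; left; apply/eqP; congr Normc.normc.
by apply/eqP; rewrite eq_complex/=; apply/andP; split; apply/eqP; ring.
Unshelve. all: by end_near.
Qed.

(** Here [X] stands for [U_V^*], [H] and [K] for the two generators, [A] for the dressing [1 - L/E]
    and [U] for [U_W]; the left side is then the derivative of [F] up to the factor [i]. *)
Lemma mulmx_intertwine (R : pzRingType) n (X H A K U P : 'M[R]_n) :
  X *m H *m (A *m U) *m P - X *m (A *m (K *m U)) *m P =
  X *m ((H *m A - A *m K) *m (U *m P)).
Proof. by rewrite [in RHS]mulmxBl [in RHS]mulmxBr !mulmxA. Qed.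

(** With [x] the penalty strength, the terms of order [x] cancel because both generators contain
    [x *: Q]. The commutator of [x *: Q] with [x^-1 *: L] has order one and is meant to cancel
    [V - c]. *)
Lemma mulmx_dressing (F : fieldType) n (x c : F) (H Q V L : 'M[F]_n) :
  x != 0 ->
  (H + x *: Q + V) *m (1%:M - x^-1 *: L)
    - (1%:M - x^-1 *: L) *m (H + x *: Q + c *: 1%:M) =
  (V - c *: 1%:M) - (Q *m L - L *m Q)
    - x^-1 *: (H *m L - L *m H + (V - c *: 1%:M) *m L).
Proof.
move=> x0.
have -> : (H + x *: Q + V) *m (1%:M - x^-1 *: L) =
    H + x *: Q + V - (x^-1 *: (H *m L) + Q *m L + x^-1 *: (V *m L)).
  rewrite mulmxBr mulmx1 -scalemxAr 2!mulmxDl 2!scalerDr.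
  by rewrite -scalemxAl scalerA mulVf// scale1r.
have -> : (1%:M - x^-1 *: L) *m (H + x *: Q + c *: 1%:M) =
    H + x *: Q + c *: 1%:M - (x^-1 *: (L *m H) + L *m Q + x^-1 *: (c *: L)).
  rewrite mulmxBl mul1mx -scalemxAl 2!mulmxDr 2!scalerDr.
  by rewrite -2!scalemxAr mulmx1 [in x^-1 *: (x *: _)]scalerA mulVf// scale1r.
rewrite [(V - _) *m L]mulmxBl -scalemxAl mul1mx.
move: (H *m L) (Q *m L) (V *m L) (L *m H) (L *m Q).
move: (c *: 1%:M : 'M[F]_n) => g a b d e f.
by apply/matrixP => i j; rewrite !mxE; ring.
Qed.

(** The factor of [E^-1] in the bound is free of [E]. The commutator equation for [L] is asked only
    after multiplication by [UW s *m P], since [V - c] is a commutator with [Hq] only there. *)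
Lemma strong_penalty_bound (R : realType) n (T c E B : R)
    (H0 UV UW : R -> 'M[R[i]]_n)
    (Hq L V P : 'M[R[i]]_n) :
  0 < T -> 0 < E ->
  (forall s, 0 <= s <= T -> herm (H0 s)) -> herm Hq -> herm V ->
  (forall s, 0 <= s <= T -> mxnorm1 (H0 s) <= B) ->
  solves T (fun s => H0 s + E%:CC *: Hq + V) UV -> UV 0 = 1%:M ->
  solves T (fun s => H0 s + E%:CC *: Hq + c%:CC *: 1%:M) UW -> UW 0 = 1%:M ->
  (forall s, 0 <= s <= T -> 
    (V - c%:CC *: 1%:M) *m (UW s *m P) = (Hq *m L - L *m Hq) *m (UW s *m P)) ->
  mxnorm1 (UV T *m P - UW T *m P) <=
    E^-1 * ((n * n)%:R ^+ 3 *
      ((B + B + mxnorm1 (V - c%:CC *: 1%:M)) * mxnorm1 L) * mxnorm1 P * T +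
      (n * n)%:R * mxnorm1 L * mxnorm1 P *+ 2).
Proof.
move=> T0 E0 hH0 hHq hV H0B sV V0 sW W0 VW.
have hHV s : 0 <= s <= T -> herm (H0 s + E%:CC *: Hq + V).
  by move=> sT; rewrite /herm !mxadjD mxadj_real hHq hV hH0.
have hHW s : 0 <= s <= T -> herm (H0 s + E%:CC *: Hq + c%:CC *: 1%:M).
  by move=> sT; rewrite /herm !mxadjD !mxadj_real mxadj1 hHq hH0.
set K := (n * n)%:R.
have iE0 : 0 <= E^-1 by rewrite invr_ge0 ltW.
have K0 : 0 <= K by rewrite ler0n.
have KV s : 0 <= s <= T -> mxnorm1 (UV s) <= K.
  by move=> sT; apply: mxnorm1_unitary; exact: solves_adjM hHV sV V0 sT.
have KW s : 0 <= s <= T -> mxnorm1 (UW s) <= K.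
  by move=> sT; apply: mxnorm1_unitary; exact: solves_adjM hHW sW W0 sT.
pose A := 1%:M - (E^-1)%:CC *: L.
pose F s := (UV s) ^t* *m (A *m UW s) *m P.
pose G s := H0 s *m L - L *m H0 s + (V - c%:CC *: 1%:M) *m L.
pose F' s := - ('i%C * (E^-1)%:CC) *: ((UV s) ^t* *m G s *m UW s *m P).
have dF s : 0 <= s <= T -> mx_deriv T F s (F' s).
  move=> sT.
  have := mx_derivMr P (mx_derivM (mx_deriv_adj (sV s sT))
    (mx_derivMl A (sW s sT))).
  congr mx_deriv.
  set HV := H0 s + _ + V; set HW := H0 s + _ + _.
  have -> : (- 'i%C *: (HV *m UV s)) ^t* = 'i%C *: ((UV s) ^t* *m HV).
    rewrite mxadjZ mxadjM hHV//; congr (_ *: _).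
    by apply/eqP; rewrite eq_complex/= oppr0 opprK !eqxx.
  have -> : ('i%C *: ((UV s)^t* *m HV) *m (A *m UW s)
      + (UV s)^t* *m (A *m (- 'i%C *: (HW *m UW s)))) *m P =
    'i%C *: ((UV s)^t* *m ((HV *m A - A *m HW) *m (UW s *m P))).
    rewrite mulmxDl -!scalemxAl -!scalemxAr -scalemxAl scaleNr -scalerBr.
    by rewrite mulmx_intertwine.
  (* By [VW] the terms of order one vanish, which leaves [G] with the factor [-1/E]. *)
  have -> : (HV *m A - A *m HW) *m (UW s *m P) =
      - (E^-1)%:CC *: (G s *m (UW s *m P)).
    rewrite /HV /HW /A fmorphV mulmx_dressing ?fmorph_eq0 ?gt_eqF// -/(G s).
    by rewrite mulmxBl mulmxBl VW// subrr sub0r -scalemxAl scaleNr.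
  by rewrite -scalemxAr scalerA mulrN /F' !mulmxA.
have GB s : 0 <= s <= T ->
    mxnorm1 (G s) <= (B + B + mxnorm1 (V - c%:CC *: 1%:M)) * mxnorm1 L.
  move=> sT; rewrite !mulrDl; apply: le_trans (mxnorm1D _ _) _.
  apply: lerD (mxnorm1M _ _); apply: le_trans (mxnorm1B _ _) _.
  apply: lerD; apply: le_trans (mxnorm1M _ _) _.
    by rewrite ler_wpM2r ?mxnorm1_ge0// H0B.
  by rewrite mulrC ler_wpM2r ?mxnorm1_ge0// H0B.
set g := _ * mxnorm1 L in GB *.
have g0 : 0 <= g.
  by apply: le_trans (mxnorm1_ge0 _) (GB 0 _); rewrite lexx ltW.
have F'B s : 0 <= s <= T -> mxnorm1 (F' s) <= E^-1 * (K ^+ 2 * g * mxnorm1 P).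
  move=> sT; rewrite mxnorm1Z normcN Normc.normcM normc_real.
  rewrite [Normc.normc 'i%C]/= expr0n expr1n add0r sqrtr1 mul1r.
  rewrite ger0_norm// ler_wpM2l//.
  apply: le_trans (mxnorm1M _ _) _; rewrite ler_wpM2r ?mxnorm1_ge0//.
  rewrite expr2 mulrAC.
  apply: le_trans (mxnorm1M _ _) _; apply: ler_pM; rewrite ?mxnorm1_ge0 ?KW//.
  apply: le_trans (mxnorm1M _ _) _; apply: ler_pM; rewrite ?mxnorm1_ge0 ?GB//.
  by rewrite mxnorm1_adj KV.
have TT : 0 <= T <= T by rewrite lexx ltW.
have FB := mx_mean_value TT dF F'B.
have /mulmx1C UU := solves_adjM hHV sV V0 TT.
(* Since [UV T] is unitary, [UV T *m (F T - F 0)] equals [A *m UW T *m P - UV T *m A *m P];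
   expanding [A] leaves the two corrections of order [1/E]. The first summand turns the [K ^+ 2] of
   the derivative bound into [K ^+ 3]. *)
have -> : UV T *m P - UW T *m P = - (UV T *m (F T - F 0))
    + (E^-1)%:CC *: (UV T *m L *m P - L *m UW T *m P).
  rewrite /F V0 W0 mxadj1 mul1mx mulmx1 mulmxBr !mulmxA UU mul1mx.
  rewrite /A !(mulmxBl, mulmxBr) -!scalemxAl -!scalemxAr mul1mx mulmx1.
  rewrite -!scalemxAl scalerBr.
  move: (UV T *m P) (UW T *m P) (_ *: _) (_ *: _) => a b d e.
  by apply/matrixP => i j; rewrite !mxE; ring.
apply: le_trans (mxnorm1D _ _) _; rewrite mxnorm1N mulrDr; apply: lerD.
  apply: le_trans (mxnorm1M _ _) _.
  have -> : E^-1 * (K ^+ 3 * g * mxnorm1 P * T) =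
    K * (E^-1 * (K ^+ 2 * g * mxnorm1 P) * T) by ring.
  by apply: ler_pM; rewrite ?mxnorm1_ge0 ?KV.
rewrite mxnorm1Z normc_real ger0_norm// ler_wpM2l//.
apply: le_trans (mxnorm1B _ _) _; rewrite mulr2n; apply: lerD.
all: apply: le_trans (mxnorm1M _ _) _; rewrite ler_wpM2r ?mxnorm1_ge0//.
all: apply: le_trans (mxnorm1M _ _) _.
  by rewrite ler_wpM2r ?mxnorm1_ge0 ?KV.
by rewrite mulrC ler_wpM2r ?mxnorm1_ge0 ?KW.
Qed.

(** * The limit of strong penalty *)

Lemma mx_cont_bounded (R : realType) n (T : R) (F : R -> 'M[R[i]]_n) :
  0 <= T -> mx_cont_on 0 T F ->
  exists B, forall t, 0 <= t <= T -> mxnorm1 (F t) <= B.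
Proof.
move=> T0 cF.
have [|c _ cmax] := @EVT_max R (fun t => mxnorm1 (F t)) 0 T T0; last first.
  by exists (mxnorm1 (F c)) => t tT; apply: cmax; rewrite in_itv.
apply/subspace_continuousP => t /=; rewrite in_itv/= => tT.
apply/cvgrPdist_le => e e0.
have e'0 : 0 < e / (n * n).+1%:R by rewrite divr_gt0.
have [d d0 dP] := cF t tT _ e'0.
apply/nbhs_ballP; exists d => //= s; rewrite /ball/= distrC => sd.
rewrite in_itv/= => sT; rewrite distrC; apply: le_trans (mxnorm1_dist _ _) _.
apply: (@le_trans _ _ ((n * n)%:R * (e / (n * n).+1%:R))); last first.
  by rewrite mulrCA ger_pMr// ler_pdivrMr// mul1r ler_nat.
apply: mxnorm1_le => i j; apply: ltW; rewrite -ltcR.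
by have := dP s sT sd i j; rewrite !mxE.
Qed.

(** Expanding [X] in matrix units, the triangle inequality and homogeneity give the bound, with [K]
    the sum of the norms of all the units. *)
Lemma unit_inv_norm_le (R : realType) n (nrm : 'M[R[i]]_n -> R) :
  unit_inv_norm nrm -> exists2 K, 0 <= K & forall X, nrm X <= K * mxnorm1 X.
Proof.
move=> [nrm_ge0 _ nrmZ nrmD _].
have nrmZE a X : nrm (a *: X) = Normc.normc a * nrm X.
  by apply: (@complexI R); rewrite nrmZ rmorphM.
have nrm0 : nrm 0 = 0 by rewrite -(scale0r 0) nrmZE Normc.normc0 mul0r.
have nrm_sum (I : finType) (F : I -> 'M[R[i]]_n) :
    nrm (\sum_i F i) <= \sum_i nrm (F i).
  apply: (big_ind2 (fun x r => nrm x <= r)) => [|x a y b xa yb|//].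
    by rewrite nrm0.
  exact: le_trans (nrmD _ _) (lerD xa yb).
exists (\sum_i \sum_j nrm (delta_mx i j)).
  by do 2!(apply: sumr_ge0 => ? _).
move=> X; rewrite {1}[X]matrix_sum_delta mulr_suml.
apply: le_trans (nrm_sum _ _) _; apply: ler_sum => i _.
rewrite mulr_suml; apply: le_trans (nrm_sum _ _) _; apply: ler_sum => j _.
by rewrite nrmZE mulrC ler_wpM2l// normc_le_mxnorm1.
Qed.

(** The product rule leaves [E Hq] between [U0] and [Up]; commuting it to the left past [U0] makes
    it part of the generator, and the phase contributes [c]. *)
Lemma solves_interaction (R : realType) n (T c E : R) (H0 : R -> 'M[R[i]]_n)
    (Hq : 'M[R[i]]_n) (U0 Up : R -> 'M[R[i]]_n) :
  (forall s, 0 <= s <= T -> Hq *m U0 s = U0 s *m Hq) ->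
  solves T H0 U0 -> solves T (fun=> E%:CC *: Hq) Up ->
  solves T (fun s => H0 s + E%:CC *: Hq + c%:CC *: 1%:M)
    (fun s => cexpi (- (c * s)) *: (U0 s *m Up s)).
Proof.
move=> HqU0 s0 sp s sT.
have := mx_derivM (mx_deriv_cexpi n T c s) (mx_derivM (s0 s sT) (sp s sT)).
set e := cexpi _.
have -> : (fun s0 : R => cexpi (- (c * s0)) *: 1%:M *m (U0 s0 *m Up s0)) =
    (fun s => cexpi (- (c * s)) *: (U0 s *m Up s)).
  by apply/funext => u; rewrite -scalemxAl mul1mx.
congr mx_deriv.
rewrite -2!(scalemxAl _ 1%:M) 2!mul1mx.
rewrite -scalemxAl -scalemxAr -scalemxAl.
rewrite -scalemxAr (mulmxA (U0 s)) -HqU0// -2!mulmxA.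
rewrite -scalemxAr 2!mulmxDl -2!scalemxAl mul1mx.
move: (U0 s *m Up s) => W; move: (H0 s *m W) (Hq *m W) => X Y.
by apply/matrixP => i j; rewrite !mxE; ring.
Qed.

(* The term [a = b] of [L] vanishes because [0^-1 = 0]. *)
Lemma commutator_block_offdiag (F : fieldType) n k (lam : 'I_k -> F)
    (Q : 'I_k -> 'M[F]_n) (V : 'M[F]_n) :
  injective lam -> (forall a, Q a *m Q a = Q a) ->
  (forall a b, a != b -> Q a *m Q b = 0) -> \sum_a Q a = 1%:M ->
  let Hq := \sum_a lam a *: Q a in
  let L := \sum_a \sum_b (lam b - lam a)^-1 *: (Q b *m V *m Q a) in
  Hq *m L - L *m Hq = V - \sum_a Q a *m V *m Q a.
Proof.
move=> lam_inj QQ Q0 Q1 Hq L.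
have HqQ a : Hq *m Q a = lam a *: Q a.
  rewrite mulmx_suml (bigD1 a)//= -scalemxAl QQ big1 ?addr0// => b ba.
  by rewrite -scalemxAl Q0// scaler0.
have QHq a : Q a *m Hq = lam a *: Q a.
  rewrite mulmx_sumr (bigD1 a)//= -scalemxAr QQ big1 ?addr0// => b ba.
  by rewrite -scalemxAr Q0 ?scaler0// eq_sym.
have VE : V = \sum_a \sum_b Q b *m V *m Q a.
  rewrite -[LHS]mulmx1 -{1}Q1 mulmx_sumr; apply: eq_bigr => a _.
  by rewrite -2!mulmx_suml Q1 mul1mx.
rewrite [X in _ = X - _]VE /L mulmx_sumr mulmx_suml -!sumrB; apply: eq_bigr => a _.
rewrite mulmx_sumr mulmx_suml -sumrB (bigD1 a)//= subrr invr0.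
rewrite [in RHS](bigD1 a)//= [RHS]addrAC subrr add0r.
rewrite !scale0r mulmx0 mul0mx subrr add0r; apply: eq_bigr => b ba.
(* Each block [Q b *m V *m Q a] is an eigenvector of the commutator with [Hq], for the eigenvalue
   [lam b - lam a] that the coefficient in [L] inverts. *)
rewrite -scalemxAl -scalemxAr 2!mulmxA HqQ -(mulmxA _ (Q a)) QHq.
rewrite -2!scalemxAl -scalemxAr -scalerBr -scalerBl scalerA mulVf ?scale1r//.
by rewrite subr_eq0 (inj_eq lam_inj).
Qed.

Theorem theorem1 (R : realType) (nS nB : nat) (T : R)
  (HS : R -> 'M[R[i]]_nS) (HB : 'M[R[i]]_nB) (Hp : 'M[R[i]]_nS)
  (k : nat) (lam : 'I_k -> R) (Pi : 'I_k -> 'M[R[i]]_nS)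
  (V : 'M[R[i]]_(nS * nB)) (P : 'M[R[i]]_nS) (c : R)
  (U0 : R -> 'M[R[i]]_(nS * nB)) (Up UV : R -> R -> 'M[R[i]]_(nS * nB))
  (nrm : 'M[R[i]]_(nS * nB) -> R) :
  0 < T ->
  mx_cont_on 0 T HS ->
  (forall t, 0 <= t <= T -> herm (HS t)) ->
  herm HB ->
  herm Hp ->
  (* spectral decomposition Hp = sum_a lam_a Pi_a, distinct eigenvalues *)
  injective lam ->
  (forall a, orth_proj (Pi a) /\ Pi a != 0) ->
  (forall a b, a != b -> Pi a *m Pi b = 0) ->
  \sum_(a < k) Pi a = 1%:M ->
  Hp = \sum_(a < k) (lam a)%:CC *: Pi a ->
  herm V ->
  orth_proj P ->
  (* U0 generated by H0(t) = HS(t) (x) I + I (x) HB *)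
  is_evolution T (fun t => HS t *t 1%:M + 1%:M *t HB) U0 ->
  (* Up generated by Ep Hp (x) I *)
  (forall Ep : R, 0 < Ep -> is_evolution T (fun _ => (Ep%:CC *: Hp) *t 1%:M) (Up Ep)) ->
  (* UV generated by HV(t) = H0(t) + Ep Hp + V *)
  (forall Ep : R, 0 < Ep -> is_evolution T
      (fun t => HS t *t 1%:M + 1%:M *t HB + (Ep%:CC *: Hp) *t 1%:M + V) (UV Ep)) ->
  (forall t, 0 <= t <= T -> HS t *m P = P *m HS t /\ HS t *m Hp = Hp *m HS t) ->
  \sum_(a < k) ((Pi a *t 1%:M) *m V *m (Pi a *t 1%:M) *m (P *t 1%:M))
     = c%:CC *: (P *t (1%:M : 'M[R[i]]_nB)) ->
  unit_inv_norm nrm ->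
  (fun Ep : R => nrm (UV Ep T *m (P *t 1%:M)
       - (cexpi (- (c * T)) *: (U0 T *m Up Ep T)) *m (P *t 1%:M)))
     x @[x --> +oo] --> 0.
Proof.
move=> T0 cHS hHS hHB hHp lam_inj PiP PiO Pi1 HpE hV [_ PP] e0 ep eV comm PVP hn.
have T0' := ltW T0; have TT : 0 <= T <= T by rewrite lexx T0'.
pose H0 t : 'M[R[i]]_(nS * nB) := HS t *t 1%:M + 1%:M *t HB.
pose P' : 'M[R[i]]_(nS * nB) := P *t 1%:M.
pose Q a : 'M[R[i]]_(nS * nB) := Pi a *t 1%:M.
pose Hq : 'M[R[i]]_(nS * nB) := Hp *t 1%:M.
have hH0 t : 0 <= t <= T -> herm (H0 t).
  by move=> tT; rewrite /herm mxadjD !mxadj_tens !mxadj1 hHB hHS.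
have hHq : herm Hq by rewrite /herm mxadj_tens mxadj1 hHp.
have hEq (E : R) t : 0 <= t <= T -> herm (E%:CC *: Hq).
  by move=> _; rewrite /herm mxadj_real hHq.
have H0_comm X t : HS t *m X = X *m HS t ->
    (X *t 1%:M) *m H0 t = H0 t *m (X *t 1%:M).
  by move=> HX; rewrite mulmxDl mulmxDr !tensmx_mul !mul1mx !mulmx1 HX.
have s0 := evolution_solves e0; have U00 := e0.1.
have HqU0 t : 0 <= t <= T -> Hq *m U0 t = U0 t *m Hq.
  move=> tT; apply: (solves_comm hH0 s0 U00 _ tT) => s sT.
  by apply: H0_comm; case: (comm s sT).
have P'U0 t : 0 <= t <= T -> P' *m U0 t = U0 t *m P'.
  move=> tT; apply: (solves_comm hH0 s0 U00 _ tT) => s sT.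
  by apply: H0_comm; case: (comm s sT).
have HqE : Hq = \sum_a (lam a)%:CC *: Q a.
  by rewrite /Hq HpE tensmx_suml; apply: eq_bigr => a _; rewrite tensmxZl.
have QQ a : Q a *m Q a = Q a.
  by rewrite tensmx_mul mulmx1; have [[_ ->]] := PiP a.
have QO a b : a != b -> Q a *m Q b = 0.
  by move=> ab; rewrite tensmx_mul PiO// tens0mx.
have Q1 : \sum_a Q a = 1%:M by rewrite -tensmx_suml Pi1 tensmx11.
have lamC_inj : injective (fun a => (lam a)%:CC).
  by move=> a b /(@complexI R)/lam_inj.
have := commutator_block_offdiag V lamC_inj QQ QO Q1.
rewrite -HqE /=; set L := \sum_a \sum_b _; set D := \sum_a Q a *m V *m Q a.
move=> HqL.
have DP : D *m P' = c%:CC *: P' by rewrite mulmx_suml.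
(* On the block of index [a], multiplication by [Hq] from either side is multiplication by
   [lam a]. *)
have DHq : D *m Hq = Hq *m D.
  rewrite mulmx_suml mulmx_sumr; apply: eq_bigr => a _.
  have -> : Hq *m (Q a *m V *m Q a) = (lam a)%:CC *: (Q a *m V *m Q a).
    rewrite HqE 2!mulmxA mulmx_suml (bigD1 a)//= -scalemxAl QQ big1 ?addr0.
      by rewrite -!scalemxAl.
    by move=> b ba; rewrite -scalemxAl QO// scaler0.
  rewrite HqE mulmx_sumr (bigD1 a)//= big1 ?addr0 => [|b ba].
    by rewrite -scalemxAr -(mulmxA _ (Q a)) QQ.
  by rewrite -scalemxAr -(mulmxA _ (Q a)) QO ?mulmx0 ?scaler0// eq_sym.
have [B HSB] := mx_cont_bounded T0' cHS.
pose B0 := ((nS * nB) * (nS * nB))%:R * (B * mxnorm1 (1%:M : 'M[R[i]]_nB))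
  + mxnorm1 ((1%:M : 'M[R[i]]_nS) *t HB).
have H0B t : 0 <= t <= T -> mxnorm1 (H0 t) <= B0.
  move=> tT; apply: le_trans (mxnorm1D _ _) _; rewrite lerD2r.
  apply: le_trans (mxnorm1_tens _ _) _; rewrite ler_wpM2l ?ler0n//.
  by rewrite ler_wpM2r ?mxnorm1_ge0 ?HSB.
have [K K0 nrmK] := unit_inv_norm_le hn.
have [C bound] : exists C, forall E, 0 < E ->
    mxnorm1 (UV E T *m P' - (cexpi (- (c * T)) *: (U0 T *m Up E T)) *m P')
      <= E^-1 * C.
  (* The constant is read off from [strong_penalty_bound]; it may be chosen before [E] because [L],
     [B0], [V] and [P'] do not depend on [E]. *)
  eexists => E E0.
  have tE : (E%:CC *: Hp) *t 1%:M = E%:CC *: Hq by rewrite tensmxZl.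
  have := evolution_solves (ep E E0); have := (ep E E0).1.
  have := evolution_solves (eV E E0); have := (eV E E0).1.
  rewrite tE => V0 sV p0 sp.
  have sW := solves_interaction c HqU0 s0 sp.
  apply: (strong_penalty_bound (B := B0) (L := L) T0 E0 hH0 hHq hV H0B sV V0 sW _ _).
    rewrite U00 p0 mulr0 oppr0 /cexpi cos0 sin0 mulmx1.
    exact: scale1r.
  move=> s sT; rewrite HqL.
  suff DW : D *m (cexpi (- (c * s)) *: (U0 s *m Up E s) *m P') =
      c%:CC *: (cexpi (- (c * s)) *: (U0 s *m Up E s) *m P').
    by rewrite 2!mulmxBl DW -(scalemxAl _ 1%:M) mul1mx.
  have UpX X : X *m Hq = Hq *m X -> X *m Up E s = Up E s *m X.
    move=> XHq; apply: (solves_comm (hEq E) sp p0 _ sT) => u _.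
    by rewrite -scalemxAl -scalemxAr XHq.
  have UpU0 : U0 s *m Up E s = Up E s *m U0 s.
    by apply: UpX; rewrite HqU0.
  rewrite -scalemxAl -scalemxAr [RHS]scalerA [c%:CC * _]mulrC -[RHS]scalerA.
  congr (_ *: _).
  (* The order matters: [Up] is first brought to the left of [U0], then [P'] passes [U0] and [D]
     passes [Up], so that [D] meets [P'] and [DP] applies. *)
  rewrite UpU0 -!(mulmxA (Up E s)) -P'U0// (mulmxA D). rewrite UpX//.
  by rewrite -mulmxA (mulmxA D) DP -scalemxAl -scalemxAr.
apply/cvgrPdist_le => e e_gt0.
near=> E; have E0 : 0 < E by near: E; exact: nbhs_pinfty_gt.
have [nrm_ge0 _ _ _ _] := hn.
rewrite sub0r normrN ger0_norm//; apply: le_trans (nrmK _) _.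
apply: (@le_trans _ _ (K * (E^-1 * C))); first by rewrite ler_wpM2l// bound.
(* The inequality becomes the lower bound [K * C / e <= E], which holds for all large [E]. *)
rewrite mulrCA mulrC ler_pdivrMr// [e * E]mulrC -ler_pdivrMr//.
Unshelve. all: by end_near.
Qed.
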